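(* Let $A$ be a left-symmetric algebra with a linear basis $X$ such that the commutator Lie algebra $A^{(-)}$ is 3-nilpotent, i.e., $[[a,b],c]=0$ for all $a,b,c\in A$, where $[a,b]=ab-ba$. Then for all $a,b,c\in A$ the following equality holds in the vertex algebra $V(A,1)$ (elements of $A$ being identified with their images in $V(A,1)$): $$(a,b,c)_{.}+(b,c,a)_{.}+(c,a,b)_{.}=0,$$ where $(a,b,c)_{.}=(a.b).c-a.(b.c)$.
   Context: All linear spaces are over a field $\Bbbk$ of characteristic zero; $\mathbb Z_+$ is the set of non-negative integers. A left-symmetric algebra is a linear space with a bilinear product $xy$ such that $(xy)z-x(yz)=(yx)z-y(xz)$. A Lie conformal algebra is a linear space $L$ with a linear operator $T$ and bilinear $n$-products $(\cdot{}_{(n)}\cdot)$, $n\in\mathbb Z_+$, such that for all $x,y\in L$ the $\lambda$-bracket $(x{}_{(\lambda)}y)=\sum_{n\ge0}\frac{\lambda^n}{n!}(x{}_{(n)}y)$ is a polynomial in $L[\lambda]$, and: $(Tx{}_{(\lambda)}y)=-\lambda(x{}_{(\lambda)}y)$, $(x{}_{(\lambda)}Ty)=(T+\lambda)(x{}_{(\lambda)}y)$; $(x{}_{(\lambda)}y)+(y{}_{(-T-\lambda)}x)=0$; $(x{}_{(\lambda)}(y{}_{(\mu)}z))-(y{}_{(\mu)}(x{}_{(\lambda)}z))=((x{}_{(\lambda)}y){}_{(\lambda+\mu)}z)$. The locality function $N_L(x,y)$ is the smallest $N\in\mathbb Z_+$ with $(x{}_{(n)}y)=0$ for all $n\ge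 N$. A vertex algebra is a linear space $V$ with a linear operator $T$, a bilinear product $x.y$ and a $\lambda$-bracket such that: (V1) $(V,.)$ is a unital left-symmetric algebra with unit $\mathbf 1$ and $T$ is a derivation of it; (V2) $V$ with $T$ and the $\lambda$-bracket is a Lie conformal algebra; (V3) for all $x,y,z\in V$: $x.y-y.x=\int_{-T}^0(x{}_{(\lambda)}y)\,d\lambda$ (that is, $\sum_{n\ge0}(-1)^n\frac{T^{n+1}}{(n+1)!}(x{}_{(n)}y)$), and $(x{}_{(\lambda)}y.z)=(x{}_{(\lambda)}y).z+y.(x{}_{(\lambda)}z)+\int_0^\lambda((x{}_{(\lambda)}y){}_{(\mu)}z)\,d\mu$. $V(A,1)$ is the universal vertex algebra $V$ generated by the set $X$ with $N_V(x,y)\le1$ and $x.y=xy$ for all $x,y\in X$ (here $xy\in A$ is the product in $A$, written as a linear combination of elements of $X$). Explicitly, let $\mathcal A(X,1)$ be the associative unital algebra generated by $T$ and $x(n)$ ($x\in X$, $n\in\mathbb Z$) with relations $[T,x(n)]=-n\,x(n-1)$ and $[x(n),y(m)]=[x(n-1),y(m+1)]$ for $x,y\in X$, $n,m\in\mathbb Z$; then $V(A,1)$ is the left $\mathcal A(X,1)$-module generated by $\mathbf 1$ with relations $T\mathbf 1=0$, $x(n)\mathbf 1=0$ ($n\ge0$), and $x(-1)y(-1)\mathbf 1=(xy)(-1)\mathbf 1$ for $x,y\in X$, where $a(n)=\sum_i\alpha_ix_i(n)$ for $a=\sum_i\alpha_ix_i\in A$. Its vertex algebra structure has vacuum $\mathbf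 1$ and operator $T$, $x\in X$ corresponds to $x(-1)\mathbf 1$, and for $v\in V(A,1)$ one has $x(n)v=(x{}_{(n)}v)$ for $n\ge0$, $x(-1)v=x.v$, and $x(n)v=-\frac1{n+1}(T(x(n+1)v)-x(n+1)Tv)$ for $n\le-2$. The map $A\to V(A,1)$ is the linear map $a\mapsto a(-1)\mathbf 1$ (not necessarily injective). *)

(* Defs.v *)
From HB Require Import structures.
From mathcomp Require Import all_boot all_order all_algebra.
From mathcomp Require Import boolp classical_sets cardinality fsbigop.

Set Implicit Arguments.
Unset Strict Implicit.
Unset Printing Implicit Defensive.

Import GRing.Theory.

Local Open Scope classical_set_scope.
Local Open Scope ring_scope.

Definition is_linear_basis (F : fieldType) (A : lmodType F) (X : set A) : Prop :=
  (forall a : A, exists (s : seq A) (k : A -> F),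
      [set` s] `<=` X /\ a = \sum_(x <- s) k x *: x) /\
  (forall (s : seq A) (k : A -> F), uniq s -> [set` s] `<=` X ->
      \sum_(x <- s) k x *: x = 0 -> forall x, x \in s -> k x = 0).

(* No unit is assumed. *)

HB.mixin Record Lmodule_isLeftSymmetric (F : fieldType) A
    of GRing.Lmodule F A := {
  lsmul : A -> A -> A ;
  lsmul_bilinear : bilinear_for *:%R *:%R lsmul ;
  lsmul_leftsym : forall x y z : A,
    lsmul (lsmul x y) z - lsmul x (lsmul y z) =
    lsmul (lsmul y x) z - lsmul y (lsmul x z)
}.

#[short(type="leftSymmetricType")]
HB.structure Definition LeftSymmetric (F : fieldType) :=
  { A of Lmodule_isLeftSymmetric F A & GRing.Lmodule F A }.

Notation "x ** y" := (lsmul x y) (at level 40, left associativity) : ring_scope.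

Definition lscomm (F : fieldType) (A : leftSymmetricType F) (a b : A) : A :=
  a ** b - b ** a.

Definition lsassoc (F : fieldType) (A : leftSymmetricType F) (a b c : A) : A :=
  (a ** b) ** c - a ** (b ** c).

(* A polynomial in L[lambda] is the finitely supported
   sequence of its coefficients, and identities in L[lambda] or L[lambda, mu]
   are written coefficientwise.  [lbracket nprod x y n] is the coefficient of
   lambda^n in (x_(lambda) y). *)

Definition lbracket (F : fieldType) (L : lmodType F) (nprod : nat -> L -> L -> L)
    (x y : L) (n : nat) : L :=
  (n`!%:R)^-1 *: nprod n x y.

HB.mixin Record Lmodule_isLieConformal (F : fieldType) L
    of GRing.Lmodule F L := {
  confT : {linear L -> L} ;
  nprod : nat -> L -> L -> L ;
  nprod_bilinear : forall n, bilinear_for *:%R *:%R (nprod n) ;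
  nprod_finite : forall x y : L,
    exists N : nat, forall n, (N <= n)%N -> nprod n x y = 0 ;
  (* (Tx_(lambda) y) = - lambda (x_(lambda) y) *)
  lbracketTl : forall (x y : L) (n : nat),
    lbracket nprod (confT x) y n =
    - (if n is m.+1 then lbracket nprod x y m else 0) ;
  (* (x_(lambda) Ty) = (T + lambda) (x_(lambda) y) *)
  lbracketTr : forall (x y : L) (n : nat),
    lbracket nprod x (confT y) n =
    confT (lbracket nprod x y n) +
    (if n is m.+1 then lbracket nprod x y m else 0) ;
  (* (x_(lambda) y) + (y_(- T - lambda) x) = 0, where
     (- T - lambda)^k = \sum_n (-1)^k 'C(k, n) T^(k - n) lambda^n; the truncated
     k - n is harmless since 'C(k, n) = 0 for k < n *)
  lbracket_skew : forall (x y : L) (n : nat),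
    lbracket nprod x y n +
    \sum_(k \in [set: nat])
       ((-1) ^+ k * 'C(k, n)%:R) *:
         iter (k - n) confT (lbracket nprod y x k) = 0 ;
  (* (x_(lambda) (y_(mu) z)) - (y_(mu) (x_(lambda) z)) =
     ((x_(lambda) y)_(lambda + mu) z), coefficient of lambda^m mu^n *)
  lbracket_jacobi : forall (x y z : L) (m n : nat),
    lbracket nprod x (lbracket nprod y z n) m -
    lbracket nprod y (lbracket nprod x z m) n =
    \sum_(k < m.+1)
      'C(m - k + n, n)%:R *:
        lbracket nprod (lbracket nprod x y k) z (m - k + n)
}.

#[short(type="lieConformalType")]
HB.structure Definition LieConformal (F : fieldType) :=
  { L of Lmodule_isLieConformal F L & GRing.Lmodule F L }.

Lemma locality_exists (F : fieldType) (L : lieConformalType F) (x y : L) :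
  exists N : nat, `[< forall n, (N <= n)%N -> nprod n x y = 0 >].
Proof. by have [N HN] := nprod_finite x y; exists N; apply/asboolP. Qed.

Definition locality (F : fieldType) (L : lieConformalType F) (x y : L) : nat :=
  ex_minn (locality_exists x y).

HB.mixin Record LieConformal_isVertexAlgebra (F : fieldType) V
    of LeftSymmetric F V & LieConformal F V := {
  vacuum : V ;
  vmul1l : forall x : V, vacuum ** x = x ;
  vmul1r : forall x : V, x ** vacuum = x ;
  confT_derivation : forall x y : V,
    confT (x ** y) = confT x ** y + x ** confT y ;
  (* x.y - y.x = \int_(- T)^0 (x_(lambda) y) dlambda *)
  vmul_comm : forall x y : V,
    x ** y - y ** x =
    \sum_(n \in [set: nat])
      ((-1) ^+ n / (n.+1)`!%:R) *: iter n.+1 confT (nprod n x y) ;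
  (* (x_(lambda) y.z) = (x_(lambda) y).z + y.(x_(lambda) z)
       + \int_0^lambda ((x_(lambda) y)_(mu) z) dmu, where the integral is
     \sum_(i, j) lambda^(i + j + 1) / (j + 1) times the coefficient of
     lambda^i mu^j *)
  lbracket_vmul : forall (x y z : V) (n : nat),
    lbracket nprod x (y ** z) n =
    lbracket nprod x y n ** z + y ** lbracket nprod x z n +
    \sum_(j < n)
      (j.+1%:R)^-1 *: lbracket nprod (lbracket nprod x y (n - j.+1)) z j
}.

#[short(type="vertexAlgType")]
HB.structure Definition VertexAlgebra (F : fieldType) :=
  { V of LeftSymmetric F V & LieConformal F V
       & LieConformal_isVertexAlgebra F V }.

Record is_vertex_morphism (F : fieldType) (V W : vertexAlgType F)
    (g : {linear V -> W}) : Prop := IsVertexMorphism {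
  vmorph_vacuum : g vacuum = vacuum ;
  vmorph_T : forall x : V, g (confT x) = confT (g x) ;
  vmorph_mul : forall x y : V, g (x ** y) = g x ** g y ;
  vmorph_nprod : forall (n : nat) (x y : V),
    g (nprod n x y) = nprod n (g x) (g y)
}.

Record is_vertex_subalgebra (F : fieldType) (V : vertexAlgType F)
    (S : set V) : Prop := IsVertexSubalgebra {
  vsub_zero : S 0 ;
  vsub_lin : forall (k : F) (x y : V), S x -> S y -> S (k *: x + y) ;
  vsub_vacuum : S vacuum ;
  vsub_T : forall x : V, S x -> S (confT x) ;
  vsub_mul : forall x y : V, S x -> S y -> S (x ** y) ;
  vsub_nprod : forall (n : nat) (x y : V), S x -> S y -> S (nprod n x y)
}.

Definition vertex_generated (F : fieldType) (V : vertexAlgType F)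
    (G : set V) : Prop :=
  forall S : set V, is_vertex_subalgebra S -> G `<=` S -> S = setT.

(* The universal vertex algebra V(A, 1).  As X is a basis of A, a map X -> V is
   the same as a linear map A -> V; the extension sends the product xy in A to
   the corresponding linear combination of images of elements of X. *)

Definition respects_VA1 (F : fieldType) (A : leftSymmetricType F) (X : set A)
    (V : vertexAlgType F) (f : {linear A -> V}) : Prop :=
  forall x y : A, X x -> X y ->
    (locality (f x) (f y) <= 1)%N /\ f x ** f y = f (x ** y).

(* [V], with [iota : A -> V], is the vertex algebra V(A, 1).  The morphism in
   [VA1_lift] is unique by [VA1_generated] (see [VA1_lift_unique]). *)
Record is_VA1 (F : fieldType) (A : leftSymmetricType F) (X : set A)
    (V : vertexAlgType F) (iota : {linear A -> V}) : Prop := IsVA1 {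
  VA1_generated : vertex_generated (iota @` X) ;
  VA1_respects : respects_VA1 X iota ;
  VA1_lift : forall (W : vertexAlgType F) (f : {linear A -> W}),
    respects_VA1 X f ->
    exists g : {linear V -> W},
      is_vertex_morphism g /\ forall x : A, X x -> g (iota x) = f x
}.

Lemma VA1_lift_unique (F : fieldType) (A : leftSymmetricType F) (X : set A)
    (V : vertexAlgType F) (iota : {linear A -> V}) (W : vertexAlgType F)
    (g h : {linear V -> W}) :
  is_VA1 X iota -> is_vertex_morphism g -> is_vertex_morphism h ->
  (forall x : A, X x -> g (iota x) = h (iota x)) -> g =1 h.
Proof.
move=> [gen _ _] [g1 gT gM gn] [h1 hT hM hn] gh v.
suff -> : [set u | g u = h u] v by [].
rewrite (gen [set u | g u = h u]) //; last by move=> _ [x Xx <-]; apply: gh.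
split=> /=; first by rewrite !linear0.
- by move=> k x y ex ey; rewrite !linearP ex ey.
- by rewrite g1 h1.
- by move=> x ex; rewrite gT hT ex.
- by move=> x y ex ey; rewrite gM hM ex ey.
- by move=> n x y ex ey; rewrite gn hn ex ey.
Qed.

(* Main.v *)
Require Import Defs.
From mathcomp Require Import all_boot all_order all_algebra.
From mathcomp Require Import boolp classical_sets fsbigop.

Set Implicit Arguments.
Unset Strict Implicit.
Unset Printing Implicit Defensive.

Import GRing.Theory.
Local Open Scope ring_scope.

(** Write [{x, y}] for the 0-product of [x] and [y] in the image of [A].  By
    locality [x.y - y.x = T{x, y}], and this commutator again lies in the image,
    so that [(T{x, y}_(lambda) z) = - lambda ({x, y}_(lambda) z)] has degree 0 in
    [lambda]; hence [({x, y}_(lambda) z) = 0].  In particular [{x, y}] commutes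
    with [Tz].  Applying [T] to [{x, y.z} = {x, y}.z + y.{x, z}] then gives
    [- (y, z, x) = {x, y}.Tz + {x, z}.Ty], because in a left-symmetric algebra
    [- (y, z, x)] is the defect of the commutator with [x] from being a
    derivation.  By skew symmetry the right-hand sides cancel in the cyclic
    sum. *)

(** Locality and compatibility with products are imposed by [respects_VA1] only on [X]; this
    principle carries them over to all of [A], one argument at a time. *)
Lemma linear_basis_ind (F : fieldType) (A : lmodType F) (X : set A)
    (P : A -> Prop) :
  is_linear_basis X -> P 0 ->
  (forall (k : F) (x y : A), P x -> P y -> P (k *: x + y)) ->
  (forall x, X x -> P x) -> forall a, P a.
Proof.
move=> [spanX _] P0 PD PX a; have [s [k [sX ->]]] := spanX a.
elim: s sX => [|x s IHs] sX; first by rewrite big_nil.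
rewrite big_cons; apply: PD.
  by apply/PX/sX; rewrite /= mem_head.
by apply: IHs => y /= ys; apply: sX; rewrite /= in_cons ys orbT.
Qed.

Lemma fsum_nat0 (M : nmodType) (G : nat -> M) :
  (forall n, (0 < n)%N -> G n = 0) -> \sum_(n \in [set: nat]) G n = G 0%N.
Proof.
move=> G0; rewrite -(@fsbig_widen _ _ _ _ [set 0%N]) ?fsbig_set1 //.
by move=> [[_ /(_ erefl)]|n _] //=; apply: G0.
Qed.

Section LeftSymmetricAlgebra.
Variables (F : fieldType) (A : leftSymmetricType F).
Implicit Types x y z : A.

Lemma lsmulPl z k x y : (k *: x + y) ** z = k *: (x ** z) + y ** z.
Proof. exact: (lsmul_bilinear.1 z k x y). Qed.

Lemma lsmulPr z k x y : z ** (k *: x + y) = k *: (z ** x) + z ** y.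
Proof. exact: (lsmul_bilinear.2 z k x y). Qed.

Lemma lsmul0l z : 0 ** z = 0 :> A.
Proof. by have := lsmulPl z (-1) 0 0; rewrite scaler0 addr0 scaleN1r addNr. Qed.

Lemma lsmul0r z : z ** 0 = 0 :> A.
Proof. by have := lsmulPr z (-1) 0 0; rewrite scaler0 addr0 scaleN1r addNr. Qed.

Lemma lsmulBl z x y : (x - y) ** z = x ** z - y ** z.
Proof. by rewrite addrC -scaleN1r lsmulPl scaleN1r addrC. Qed.

Lemma lsmulBr z x y : z ** (x - y) = z ** x - z ** y.
Proof. by rewrite addrC -scaleN1r lsmulPr scaleN1r addrC. Qed.

Lemma lsmulNl z x : (- x) ** z = - (x ** z).
Proof. by rewrite -sub0r lsmulBl lsmul0l sub0r. Qed.

Lemma lscomm_mulr x y z :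
  lscomm x (y ** z) = lscomm x y ** z + y ** lscomm x z - lsassoc y z x.
Proof.
have xyz : x ** (y ** z) = x ** y ** z - y ** x ** z + y ** (x ** z).
  have /eqP := lsmul_leftsym x y z; rewrite subr_eq => /eqP ->.
  by rewrite -(addrA (y ** x ** z)) (addrC (y ** x ** z)) addrK addrAC addNr add0r.
by rewrite /lscomm /lsassoc lsmulBl lsmulBr xyz opprB !addrA subrK.
Qed.

End LeftSymmetricAlgebra.

Section VertexAlgebra.
Variables (F : fieldType) (V : vertexAlgType F).
Implicit Types x y z : V.

Lemma nprodPl n z k x y :
  nprod n (k *: x + y) z = k *: nprod n x z + nprod n y z.
Proof. exact: ((nprod_bilinear n).1 z k x y). Qed.

Lemma nprodPr n z k x y :
  nprod n z (k *: x + y) = k *: nprod n z x + nprod n z y.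
Proof. exact: ((nprod_bilinear n).2 z k x y). Qed.

Lemma nprod0l n z : nprod n 0 z = 0 :> V.
Proof. by have := nprodPl n z (-1) 0 0; rewrite scaler0 addr0 scaleN1r addNr. Qed.

Lemma nprod0r n z : nprod n z 0 = 0 :> V.
Proof. by have := nprodPr n z (-1) 0 0; rewrite scaler0 addr0 scaleN1r addNr. Qed.

Lemma lbracket0 x y : lbracket nprod x y 0 = nprod 0 x y.
Proof. by rewrite /lbracket fact0 invr1 scale1r. Qed.

Lemma locality_le1 x y :
  (locality x y <= 1)%N -> forall n, (0 < n)%N -> nprod n x y = 0.
Proof.
rewrite /locality; case: ex_minnP => N /asboolP xyN _ N1 n n0.
exact/xyN/(leq_trans N1 n0).
Qed.

Lemma confT_iter0 n : iter n (@confT F V) 0 = 0.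
Proof. by elim: n => //= n ->; rewrite linear0. Qed.

Lemma confT_nprod0 x y :
  (forall n, (0 < n)%N -> nprod n x y = 0) ->
  confT (nprod 0 x y) = lscomm x y.
Proof.
move=> xy0; rewrite /lscomm vmul_comm fsum_nat0 ?divr1 ?scale1r//.
by move=> n /xy0 ->; rewrite confT_iter0 scaler0.
Qed.

(** The lambda^0 coefficient of skew symmetry involves every [nprod k y x], each under T^k; locality
    leaves only k = 0. *)
Lemma nprod0_skew x y :
  (forall n, (0 < n)%N -> nprod n y x = 0) -> nprod 0 x y = - nprod 0 y x.
Proof.
move=> yx0; apply/eqP; rewrite -addr_eq0; apply/eqP.
have := lbracket_skew x y 0; rewrite fsum_nat0.
  by rewrite expr0 bin0 mul1r scale1r !lbracket0.
by move=> n /yx0 yxn; rewrite /lbracket yxn scaler0 confT_iter0 scaler0.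
Qed.

(** The integral from 0 to lambda in the Wick formula has no constant term. *)
Lemma nprod0_mulr x y z :
  nprod 0 x (y ** z) = nprod 0 x y ** z + y ** nprod 0 x z.
Proof. by have := lbracket_vmul x y z 0; rewrite !lbracket0 big_ord0 addr0. Qed.

(** The factor - lambda shifts degrees by one: coefficient n for [x] is, up to sign, coefficient n +
    1 for [confT x], and n + 1 is always positive. *)
Lemma lbracket_confT_eq0 x y :
  (forall n, (0 < n)%N -> nprod n (confT x) y = 0) ->
  forall n, lbracket nprod x y n = 0.
Proof.
move=> Txy0 n; apply/eqP; rewrite -oppr_eq0 -(lbracketTl x y n.+1); apply/eqP.
by rewrite /lbracket Txy0 // scaler0.
Qed.

(** Since (x_(lambda) Ty) = (T + lambda)(x_(lambda) y) = 0, the integral expressing the commutator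
    vanishes. *)
Lemma lbracket_eq0_mul_confT (charF0 : [pchar F] =i pred0) x y :
  (forall n, lbracket nprod x y n = 0) -> x ** confT y = confT y ** x.
Proof.
move=> xy0; apply/eqP; rewrite -subr_eq0 vmul_comm fsbig1 // => n _.
have /eqP : lbracket nprod x (confT y) n = 0.
  by rewrite lbracketTr xy0 linear0 add0r; case: n.
(* In characteristic zero the factor 1/n! in [lbracket] is nonzero, so the n-product itself
   vanishes. *)
rewrite /lbracket scaler_eq0 invr_eq0 ((pcharf0P F).1 charF0) -leqn0 leqNgt fact_gt0 /=.
by move=> /eqP ->; rewrite confT_iter0 linear0 scaler0.
Qed.

End VertexAlgebra.

Section UniversalMap.
Variables (F : fieldType) (A : leftSymmetricType F) (X : set A).
Variables (V : vertexAlgType F) (f : {linear A -> V}).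
Hypotheses (basisX : is_linear_basis X) (fX : respects_VA1 X f).

Lemma respects_VA1_nprod (a b : A) n : (0 < n)%N -> nprod n (f a) (f b) = 0.
Proof.
move=> n0; move: a; apply: (linear_basis_ind basisX) => [|k x y xb yb|x Xx].
- by rewrite linear0 nprod0l.
- by rewrite linearP nprodPl xb yb scaler0 addr0.
move: b; apply: (linear_basis_ind basisX) => [|k y z xy xz|y Xy].
- by rewrite linear0 nprod0r.
- by rewrite linearP nprodPr xy xz scaler0 addr0.
exact: (locality_le1 (fX Xx Xy).1).
Qed.

Lemma respects_VA1_mul (a b : A) : f a ** f b = f (a ** b).
Proof.
move: a; apply: (linear_basis_ind basisX) => [|k x y xb yb|x Xx].
- by rewrite linear0 !lsmul0l linear0.
- by rewrite linearP !lsmulPl xb yb linearP.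
move: b; apply: (linear_basis_ind basisX) => [|k y z xy xz|y Xy].
- by rewrite linear0 !lsmul0r linear0.
- by rewrite linearP !lsmulPr xy xz linearP.
exact: (fX Xx Xy).2.
Qed.

Lemma confT_nprod0_image (a b : A) :
  confT (nprod 0 (f a) (f b)) = f (lscomm a b).
Proof.
rewrite confT_nprod0; last exact: respects_VA1_nprod.
by rewrite /lscomm !respects_VA1_mul linearB.
Qed.

Lemma lsassoc_image (charF0 : [pchar F] =i pred0) (a b c : A) :
  lsassoc (f a) (f b) (f c) =
  - (nprod 0 (f c) (f a) ** confT (f b) + nprod 0 (f c) (f b) ** confT (f a)).
Proof.
have comm : nprod 0 (f c) (f b) ** confT (f a) =
            confT (f a) ** nprod 0 (f c) (f b).
  apply: lbracket_eq0_mul_confT => //; apply: lbracket_confT_eq0 => n n0.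
  by rewrite confT_nprod0_image respects_VA1_nprod.
have := congr1 confT (nprod0_mulr (f c) (f a) (f b)).
have T0 x y := confT_nprod0 (respects_VA1_nprod x y).
(* The product [f a ** f b] lies in the image of [A], so [T0] also turns the left-hand side into a
   commutator. *)
rewrite linearD !confT_derivation !T0 {1}respects_VA1_mul T0.
rewrite -respects_VA1_mul lscomm_mulr comm.
(* The terms [c, a].b + a.[c, b] occur on both sides; cancelling them isolates the associator. *)
rewrite [_ + f a ** _ in RHS]addrC [RHS]addrACA => /addrI <-.
by rewrite opprK.
Qed.

End UniversalMap.

Theorem proposition4 (F : fieldType) (charF0 : [pchar F] =i pred0)
    (A : leftSymmetricType F) (X : set A) (basisX : is_linear_basis X)
    (nilA : forall a b c : A, lscomm (lscomm a b) c = 0)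
    (V : vertexAlgType F) (iota : {linear A -> V}) (VA1 : is_VA1 X iota)
    (a b c : A) :
  lsassoc (iota a) (iota b) (iota c) +
  lsassoc (iota b) (iota c) (iota a) +
  lsassoc (iota c) (iota a) (iota b) = 0.
Proof.
have iotaX := VA1_respects VA1.
rewrite !(lsassoc_image basisX iotaX charF0).
have skew x y : nprod 0 (iota x) (iota y) = - nprod 0 (iota y) (iota x).
  exact/nprod0_skew/(respects_VA1_nprod basisX iotaX).
(* One orientation is fixed for each pair, so that the two terms sharing a factor [confT] become
   opposite. *)
rewrite (skew a c) (skew b a) (skew c b) !lsmulNl.
by rewrite !opprB !addrA !subrK subrr.
Qed.
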